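(* Let $k\ge 3$ and let $G=(V,E)$ be a $k$-uniform connected hypergraph with maximum degree $d>0$, and let $\mathcal Q$ be the signless Laplacian tensor of $G$. Then $$\lambda(\mathcal Q)\ \ge\ d+d\left(\frac1{\alpha_*}\right)^{k-1},$$ where $\alpha_*\in(d-1,d]$ is the largest real root of $\alpha^k+(1-d)\alpha^{k-1}-d=0$, with equality holding if and only if $G$ is a hyperstar.
   Context: Hypergraphs are undirected, simple, $k$-uniform (every edge has exactly $k$ vertices), with vertex set $V=[n]=\{1,\dots,n\}$, $n\ge k$, and nonempty edge set $E$. The degree $d_i$ of vertex $i$ is the number of edges containing $i$. Two different vertices $i,j$ are connected if there are edges $e_1,\dots,e_m$ with $i\in e_1$, $j\in e_m$ and $e_r\cap e_{r+1}\ne\emptyset$ for all $r\in[m-1]$; $G$ is connected if every pair of different vertices is connected. The adjacency tensor $\mathcal A$ is the $k$-th order $n$-dimensional tensor with $a_{i_1\dots i_k}=\frac1{(k-1)!}$ if $\{i_1,\dots,i_k\}\in E$ and $0$ otherwise; $\mathcal D$ is the diagonal tensor with diagonal entries $d_{i\dots i}=d_i$; the signless Laplacian tensor is $\mathcal Q=\mathcal D+\mathcal A$. Thus $(\mathcal Q\mathbf x^{k-1})_i=d_ix_i^{k-1}+\sum_{e\in E,\,i\in e}\prod_{j\in e\setminus\{i\}}x_j$. A real number $\lambda$ is an H-eigenvalue of $\mathcal Q$ with H-eigenvector $\mathbf x\in\mathbb R^n\setminus\{0\}$ if $(\mathcal Q\mathbf x^{k-1})_i=\lambda x_i^{k-1}$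 for all $i\in[n]$. $\lambda(\mathcal Q)$ denotes the largest H-eigenvalue of $\mathcal Q$ (it exists). A $k$-uniform hypergraph $G=(V,E)$ is a hyperstar (of size $t\ge 1$) if there is a disjoint partition $V=V_0\cup V_1\cup\dots\cup V_t$ with $|V_0|=1$, $|V_1|=\dots=|V_t|=k-1$ and $E=\{V_0\cup V_i : i\in[t]\}$; a single edge (size $1$) counts as a hyperstar. *)

(* Defs.v *)
From HB Require Import structures.
From mathcomp Require Import all_boot all_order all_algebra.
From mathcomp Require Import reals.

Set Implicit Arguments.
Unset Strict Implicit.
Unset Printing Implicit Defensive.

Import Order.TTheory GRing.Theory Num.Theory.

Local Open Scope ring_scope.

(* A simple undirected hypergraph on the vertex type V is its edge set
   E : {set {set V}}. *)

Section Hypergraph.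

Variable V : finType.
Implicit Types (E : {set {set V}}) (k t : nat) (i j : V).

Definition uniform k E : Prop := forall e, e \in E -> #|e| = k.

Definition degree E i : nat := #|[set e in E | i \in e]|.

Definition max_degree E : nat := (\max_(i : V) degree E i)%N.

(* The chain e_1, ..., e_m of edges is e :: p, so m >= 1. *)
Definition linked E i j : Prop :=
  exists (e : {set V}) (p : seq {set V}),
    [/\ all (fun f => f \in E) (e :: p),
        path (fun f g => f :&: g != set0) e p,
        i \in e & j \in last e p].

Definition hconnected E : Prop := forall i j, i != j -> linked E i j.

Definition hyperstar_of_size k t E : Prop :=
  exists (V0 : {set V}) (W : 'I_t -> {set V}),
    [/\ [/\ V0 :|: \bigcup_(s < t) W s = [set: V],
            forall s, [disjoint V0 & W s]
          & forall r s, r != s -> [disjoint W r & W s]],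
        #|V0| = 1%N,
        forall s, #|W s| = k.-1
      & E = [set V0 :|: W s | s : 'I_t]].

Definition hyperstar k E : Prop :=
  exists2 t, (1 <= t)%N & hyperstar_of_size k t E.

End Hypergraph.

(* k-th order n-dimensional tensors; the entry t_{i_1 ... i_k} is the value
   at the tuple (i_1, ..., i_k). *)
Notation tensor R k n := {ffun k.-tuple 'I_n -> R}.

Section Tensors.

Variables (R : realType) (k n : nat).
Implicit Types (T : tensor R k n) (x : 'rV[R]_n) (E : {set {set 'I_n}}).

(* (T x^{k-1})_i, the sum over i_2, ..., i_k of
   t_{i i_2 ... i_k} x_{i_2} ... x_{i_k}: the index t runs over the k-tuples
   whose first component is i.  Only meaningful for k >= 1. *)
Definition tensor_apply T x (i : 'I_n) : R :=
  \sum_(t : k.-tuple 'I_n | ohead t == Some i)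
     T t * \prod_(j <- behead t) x 0 j.

Definition H_eigenvalue T (lam : R) : Prop :=
  exists2 x : 'rV[R]_n, x != 0 &
    forall i, tensor_apply T x i = lam * x 0 i ^+ k.-1.

Definition adjacency_tensor E : tensor R k n :=
  [ffun t : k.-tuple 'I_n =>
     if [set j in t] \in E then (k.-1)`!%:R^-1 else 0].

(* For k >= 1 the sum has a single term if t = (i, ..., i), and none if t is
   off the diagonal. *)
Definition degree_tensor E : tensor R k n :=
  [ffun t : k.-tuple 'I_n =>
     \sum_(i < n | t == [tuple of nseq k i]) (degree E i)%:R].

Definition signless_laplacian E : tensor R k n :=
  degree_tensor E + adjacency_tensor E.

End Tensors.

Definition is_greatest (R : realType) (P : R -> Prop) (m : R) : Prop :=
  P m /\ forall y, P y -> y <= m.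

(* Hence "there is a greatest m with P m, and it satisfies C" says the same
   as "the greatest m with P m exists, and C holds for it". *)
Lemma is_greatest_unique (R : realType) (P : R -> Prop) (m m' : R) :
  is_greatest P m -> is_greatest P m' -> m = m'.
Proof.
by move=> [Pm mP] [Pm' m'P]; apply/le_anti; rewrite m'P //= mP.
Qed.

Definition alpha_poly (R : realType) (k d : nat) : {poly R} :=
  'X^k + (1 - d%:R) *: 'X^(k.-1) - d%:R%:P.

(* Main.v *)
(* For nonnegative x let q(x) = sum_i d_i x_i^k + k sum_e prod_(j in e) x_j, so
   that q(x) is the sum of the x_i (Q x^(k-1))_i, and let lam be the maximum of
   q(x) / sum_i x_i^k, attained on the standard simplex.  A coordinatewise
   variation at a maximizer gives the eigenvalue equation, also at the
   coordinates that vanish, so lam is an H-eigenvalue without any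
   Perron-Frobenius argument; applying q to |y| bounds every other H-eigenvalue
   by lam.
   Put L = 1 + alpha = d + d / alpha^(k-1).  The test vector equal to alpha at
   a vertex v of degree d, 1 on its neighbourhood N and 0 elsewhere gives
     (lam - L) (alpha^k + |N|) >=
       (sum_(j in N) d_j - |N|) + alpha (d (k-1) - |N|),
   where both terms on the right are nonnegative.  If lam = L, then every
   vertex of N has degree 1, and by connectedness G is a hyperstar centred at
   v.  Conversely, on a hyperstar AM-GM applied to each edge gives
   q(x) <= L sum_i x_i^k. *)

Require Import Defs.
From HB Require Import structures.
From mathcomp Require Import classical_sets topology normedtype derive realfun.
From mathcomp Require Import all_boot all_order all_algebra.
From mathcomp Require Import reals ring lra.

Set Implicit Arguments.
Unset Strict Implicit.
Unset Printing Implicit Defensive.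

Import Order.TTheory GRing.Theory Num.Theory.
Import numFieldNormedType.Exports.

Local Open Scope ring_scope.

(** * Edge polynomials of a weight function, and the upper bound for all H-eigenvalues *)

Section EdgePolynomials.

Variables (R : realFieldType) (V : finType) (k : nat) (E : {set {set V}}).
Implicit Types (x y : V -> R) (i : V).

(** The adjacency part of [(Q x^(k-1))_i], as a sum over edges instead of tuples. *)
Definition link_sum x i : R := \sum_(e in E | i \in e) \prod_(j in e :\ i) x j.

Definition power_sum x : R := \sum_i x i ^+ k.

Definition qform x : R :=
  \sum_i (degree E i)%:R * x i ^+ k + k%:R * \sum_(e in E) \prod_(j in e) x j.

Definition upd x i t : V -> R := fun j => if j == i then t else x j.

Lemma prod_edgeD1 x i (e : {set V}) :
  i \in e -> \prod_(j in e) x j = x i * \prod_(j in e :\ i) x j.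
Proof. by move=> ie; rewrite (big_setD1 i). Qed.

Lemma updE x i t : upd x i t i = t.
Proof. by rewrite /upd eqxx. Qed.

Lemma updNE x i t j : j != i -> upd x i t j = x j.
Proof. by rewrite /upd => /negbTE->. Qed.

Lemma power_sum_upd x i t :
  power_sum (upd x i t) = power_sum x + (t ^+ k - x i ^+ k).
Proof.
rewrite /power_sum (bigD1 i) //= [in RHS](bigD1 i) //= updE.
rewrite (eq_bigr (fun j => x j ^+ k)); first by ring.
by move=> j ji; rewrite updNE.
Qed.

(** Each edge product is affine in the coordinate [x i], with slope the product over [e :\ i], so
    the change is exact and not only of first order. *)
Lemma qform_upd x i t :
  qform (upd x i t) = qform x + (degree E i)%:R * (t ^+ k - x i ^+ k)
    + k%:R * ((t - x i) * link_sum x i).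
Proof.
rewrite /qform /link_sum (bigD1 i) //= [in RHS](bigD1 i) //= updE.
rewrite (eq_bigr (fun j => (degree E j)%:R * x j ^+ k)); last first.
  by move=> j ji; rewrite updNE.
rewrite (eq_bigr (fun e : {set V} => \prod_(j in e) x j +
    if i \in e then (t - x i) * \prod_(j in e :\ i) x j else 0)) /=; last first.
  move=> e _; case: ifP => [ie|/negbT nie]; last first.
    rewrite addr0; apply: eq_bigr => j je; rewrite updNE //.
    by apply: contraNneq nie => <-.
  have upd_prod : \prod_(j in e :\ i) upd x i t j = \prod_(j in e :\ i) x j.
    by apply: eq_bigr => j; rewrite !inE => /andP[ji _]; rewrite updNE.
  by rewrite !(prod_edgeD1 _ ie) updE upd_prod; ring.
by rewrite big_split /= -big_mkcondr /= -mulr_sumr; ring.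
Qed.

Lemma link_sum_ge0 x i : (forall j, 0 <= x j) -> 0 <= link_sum x i.
Proof. by move=> x0; apply: sumr_ge0 => e _; apply: prodr_ge0. Qed.

Lemma power_sum_gt0 x i : (forall j, 0 <= x j) -> x i != 0 -> 0 < power_sum x.
Proof.
move=> x0 xi; rewrite /power_sum (bigD1 i) //= ltr_wpDr //.
  by apply: sumr_ge0 => j _; apply: exprn_ge0.
by rewrite exprn_gt0 // lt_neqAle eq_sym xi x0.
Qed.

Lemma eq_qform x y : x =1 y -> qform x = qform y.
Proof.
move=> xy; rewrite /qform; congr (_ + _ * _).
  by apply: eq_bigr => i _; rewrite xy.
by apply: eq_bigr => e _; apply: eq_bigr => j _; rewrite xy.
Qed.

Lemma eq_power_sum x y : x =1 y -> power_sum x = power_sum y.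
Proof. by move=> xy; apply: eq_bigr => i _; rewrite xy. Qed.

Lemma qformZ x (c : R) : uniform k E ->
  qform (fun j => c * x j) = c ^+ k * qform x.
Proof.
move=> unif; rewrite /qform mulrDr; congr (_ + _).
  by rewrite mulr_sumr; apply: eq_bigr => i _; rewrite exprMn; ring.
rewrite mulrCA; congr (_ * _); rewrite mulr_sumr; apply: eq_bigr => e eE.
by rewrite big_split /= prodr_const unif.
Qed.

Lemma power_sumZ x (c : R) :
  power_sum (fun j => c * x j) = c ^+ k * power_sum x.
Proof.
by rewrite /power_sum mulr_sumr; apply: eq_bigr => i _; rewrite exprMn.
Qed.

(** Exchanging the sums counts each edge once for each of its [k] vertices, hence the factor [k] in
    [qform]. *)
Lemma euler_identity x : (0 < k)%N -> uniform k E ->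
  \sum_i x i * ((degree E i)%:R * x i ^+ k.-1 + link_sum x i) = qform x.
Proof.
move=> k0 unif; rewrite /qform.
under eq_bigr => i _ do rewrite mulrDr mulrCA -exprS prednK //.
rewrite big_split /=; congr (_ + _).
transitivity (\sum_i \sum_(e in E | i \in e) \prod_(j in e) x j).
  apply: eq_bigr => i _; rewrite mulr_sumr; apply: eq_bigr => e /andP[_ ie].
  by rewrite -(prod_edgeD1 _ ie).
rewrite (exchange_big_dep (mem E)) /=; last by move=> i e _ /andP[].
rewrite mulr_sumr; apply: eq_bigr => e eE.
rewrite (eq_bigl (mem e)) ?sumr_const ?unif ?mulr_natl //.
by move=> i; rewrite eE.
Qed.

(** With [y = |x|], the triangle inequality gives [(mu - d_i) y_i^(k-1) <= link_sum y i], whatever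
    the sign of [mu - d_i]. Multiplying by [y_i] and summing yields [mu * power_sum y <= qform y] by
    [euler_identity]. *)
Lemma eigenvalue_le mu lam x : (0 < k)%N -> uniform k E ->
  (forall y, (forall j, 0 <= y j) -> qform y <= lam * power_sum y) ->
  (exists i, x i != 0) ->
  (forall i, (degree E i)%:R * x i ^+ k.-1 + link_sum x i = mu * x i ^+ k.-1) ->
  mu <= lam.
Proof.
move=> k0 unif hlam [i xi] hx.
pose y j := `|x j|.
have y0 j : 0 <= y j by rewrite /y.
have py : 0 < power_sum y.
  by apply: (@power_sum_gt0 y i) => //; rewrite normr_eq0.
rewrite -(ler_pM2r py); apply: le_trans (hlam y y0).
rewrite -euler_identity // /power_sum mulr_sumr; apply: ler_sum => j _.
rewrite -{1}(prednK k0) exprS mulrCA ler_wpM2l //.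
rewrite -lerBlDl -mulrBl.
have -> : y j ^+ k.-1 = `|x j ^+ k.-1| by rewrite normrX.
apply: le_trans (ler_norm _) _; rewrite normrM normr_id -normrM mulrBl -hx.
rewrite addrAC subrr add0r; apply: le_trans (ler_norm_sum _ _ _) _.
by apply: ler_sum => e _; rewrite normr_prod.
Qed.

End EdgePolynomials.

(** * Hyperstars described by a centre and by degrees *)

Section Star.
Variables (V : finType).
Implicit Types (E : {set {set V}}) (v j : V).

(** Avoids the partition: different edges meet only in [v]. Vertices outside all edges are not seen
    here, so the way back to [hyperstar] uses connectivity. *)
Definition is_star E v :=
  (forall e, e \in E -> v \in e) /\ (forall j, j != v -> (degree E j <= 1)%N).

Lemma degree_gt0 E e j : e \in E -> j \in e -> (0 < degree E j)%N.
Proof. by move=> eE je; apply/card_gt0P; exists e; rewrite inE eE. Qed.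

Lemma degree_le1 E e f j : (degree E j <= 1)%N ->
  e \in E -> f \in E -> j \in e -> j \in f -> e = f.
Proof.
by move=> /card_le1_eqP h eE fE je jf; apply: h; rewrite inE ?eE ?fE.
Qed.

Lemma hyperstar_is_star k E : hyperstar k E -> exists v, is_star E v.
Proof.
move=> [t _ [V0 [W [[_ _ disj] /eqP/cards1P[v ->] _ ->]]]].
exists v; split.
  by move=> e /imsetP[s _ ->]; rewrite !inE eqxx.
move=> j jv; apply/card_le1_eqP => e f.
rewrite !inE => /andP[/imsetP[r _ ->]] /[!inE] /[!(negbTE jv)]/= jr.
move=> /andP[/imsetP[s _ ->]] /[!inE] /[!(negbTE jv)]/= js.
have [->//|rs] := eqVneq r s.
by have /pred0P/(_ j)/= := disj _ _ rs; rewrite jr js.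
Qed.

Lemma is_star_hyperstar k E v : (0 < k)%N -> E != set0 -> uniform k E ->
  hconnected E -> is_star E v -> hyperstar k E.
Proof.
move=> k0 E0 unif conn [cent deg1]; exists #|E|; first by rewrite card_gt0.
have eE (s : 'I_#|E|) : enum_val s \in E by apply: enum_valP.
(* The blocks are the edges without their centre, indexed by an enumeration of [E]. *)
exists [set v], (fun s => enum_val s :\ v); split.
- split.
  + apply/setP => j; rewrite !inE; have [//|jv] := eqVneq j v.
    have [e [p [/allP ep _ _ jl]]] := conn v j (contra_neq esym jv).
    have lE : last e p \in E by apply/ep/mem_last.
    apply/bigcupP; exists (enum_rank_in lE (last e p)) => //.
    by rewrite enum_rankK_in // !inE jv.
  + by move=> s; rewrite disjoints1 !inE eqxx.
  + move=> r s rs; apply/pred0P => j /=; rewrite !inE.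
    have [//|jv] := eqVneq j v; apply/negP => /andP[/= jr js].
    move/eqP: rs; apply; apply: enum_val_inj.
    exact: (degree_le1 (deg1 j jv)).
- exact: cards1.
- by move=> s; have := cardsD1 v (enum_val s); rewrite unif // cent // => ->.
- apply/setP => e; apply/idP/imsetP => [eE'|[s _ ->]].
    exists (enum_rank_in eE' e) => //; rewrite enum_rankK_in //.
    by rewrite setD1K ?cent.
  by rewrite setD1K ?cent.
Qed.

(** A chain can leave an edge at [v] only through [v] itself, since the other vertices of that edge
    lie in no second edge. So a chain starting at [v] stays among the edges containing [v], and
    every vertex is a neighbour of [v]. *)
Lemma neighbours_degree1_is_star E v : (forall e, e \in E -> 1 < #|e|)%N ->
  hconnected E ->
  (forall e j, e \in E -> v \in e -> j \in e -> j != v ->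
    (degree E j <= 1)%N) ->
  is_star E v.
Proof.
move=> card2 conn deg1.
have step e f : e \in E -> f \in E -> v \in e -> e :&: f != set0 -> v \in f.
  move=> eE fE ve /set0Pn[w]; rewrite inE => /andP[we wf].
  have [<-//|wv] := eqVneq w v.
  by rewrite -(degree_le1 (deg1 _ _ eE ve we wv) eE fE we wf).
have reach p : forall e, all (fun f => f \in E) (e :: p) ->
    path (fun f g => f :&: g != set0) e p -> v \in e -> v \in last e p.
  elim: p => [//|f p IH] e /= /and3P[eE fE pE] /andP[ef fp] ve.
  by apply: IH => //=; [rewrite fE | apply: step ef].
have nbr j : j != v -> exists e, [/\ e \in E, v \in e & j \in e].
  move=> jv; have [e [p [ep pp ve jl]]] := conn v j (contra_neq esym jv).
  exists (last e p); split; rewrite ?(reach p) //.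
  by move/allP: ep; apply; apply: mem_last.
split=> [f fE|j jv]; last by have [e [eE ve je]] := nbr j jv; apply: (deg1 e).
have /card_gt1P[u [w [uf wf uw]]] := card2 f fE.
wlog uv : u w uf wf uw / u != v => [hw|].
  have [uv|] := eqVneq u v; last exact: hw uw.
  by apply: (hw w u) => //; rewrite 1?eq_sym // -uv.
have [e [eE ve ue]] := nbr u uv.
by rewrite -(degree_le1 (deg1 e u eE ve ue uv) eE fE ue uf).
Qed.

End Star.

(** * Counting the neighbours of a vertex *)

Section Neighbourhood.
Variables (V : finType) (E : {set {set V}}) (v : V).

Definition nbhd : {set V} := (\bigcup_(e in E | v \in e) e) :\ v.

Lemma nbhdP j :
  reflect [/\ j != v & exists e, [/\ e \in E, v \in e & j \in e]] (j \in nbhd).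
Proof.
rewrite !inE; apply: (iffP andP) => -[jv].
  by move=> /bigcupP[e /andP[eE ve] je]; split=> //; exists e.
by move=> [e [eE ve je]]; split=> //; apply/bigcupP; exists e => //; apply/andP.
Qed.

Lemma degree_nbhd_gt0 j : j \in nbhd -> (0 < degree E j)%N.
Proof. by move=> /nbhdP[_ [e [eE _ je]]]; apply: degree_gt0 je. Qed.

Lemma card_nbhd_le_degree : (#|nbhd| <= \sum_(j in nbhd) degree E j)%N.
Proof. by rewrite -sum1_card; apply: leq_sum => j /degree_nbhd_gt0. Qed.

(** A union bound: each edge at [v] brings at most [k.-1] new vertices. *)
Lemma card_nbhd_le k : uniform k E -> (#|nbhd| <= degree E v * k.-1)%N.
Proof.
move=> unif; rewrite /nbhd setDE big_distrl /= -sum_nat_const.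
rewrite (eq_bigr (fun e : {set V} => #|e :\ v|)); last first.
  move=> e /[!inE]/andP[eE ve]; have := cardsD1 v e.
  by rewrite ve unif // => ->.
rewrite [leqRHS](eq_bigl (fun e => (e \in E) && (v \in e))); last first.
  by move=> e; rewrite inE.
apply: (big_rec2 (fun (A : {set V}) n => #|A| <= n)%N); first by rewrite cards0.
move=> e A n _ le_n; rewrite -setDE.
by apply: leq_trans (leq_card_setU _ _) _; rewrite leq_add2l.
Qed.

(** All terms of the sum are at least 1, so one larger term would break the equality. *)
Lemma nbhd_degree1 :
  (#|nbhd| = \sum_(j in nbhd) degree E j)%N ->
  forall j, j \in nbhd -> (degree E j <= 1)%N.
Proof.
move=> cardN j jN; rewrite leqNgt; apply/negP => deg2.
have : (#|nbhd| < \sum_(j in nbhd) degree E j)%N.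
  rewrite -sum1_card (bigD1 j) //= [ltnRHS](bigD1 j) //= -addSn leq_add //.
  by apply: leq_sum => i /andP[/degree_nbhd_gt0].
by rewrite -cardN ltnn.
Qed.

End Neighbourhood.

(** * Lower bound by the test vector, upper bound on hyperstars, and the equality case *)

Section Extremal.
Variables (R : realFieldType) (V : finType) (k d : nat) (E : {set {set V}}).
Variables (alpha : R) (v : V).
Hypotheses (k0 : (0 < k)%N) (alpha_gt0 : 0 < alpha) (unif : uniform k E).
Hypothesis alphaE : 1 + alpha = d%:R + d%:R * (1 / alpha) ^+ k.-1.

Definition star_vector (j : V) : R :=
  if j == v then alpha else (j \in nbhd E v)%:R.

Lemma star_vector_ge0 j : 0 <= star_vector j.
Proof. by rewrite /star_vector; case: ifP => // _; apply: ltW. Qed.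

Lemma star_vectorN j : j \in nbhd E v -> star_vector j = 1.
Proof. by move=> jN; rewrite /star_vector jN; case/nbhdP: jN => /negbTE->. Qed.

Lemma sum_star_vector (c : V -> R) : \sum_i c i * star_vector i ^+ k =
  c v * alpha ^+ k + \sum_(j in nbhd E v) c j.
Proof.
rewrite (bigD1 v) //= {1}/star_vector eqxx; congr (_ + _).
rewrite [RHS]big_mkcond [RHS](bigD1 v) //= {1}/nbhd !inE eqxx /= add0r.
apply: eq_bigr => j /negbTE jv; rewrite /star_vector jv.
by case: ifP; rewrite ?expr1n ?mulr1 // expr0n eqn0Ngt k0 mulr0.
Qed.

Lemma power_sum_star_vector :
  power_sum k star_vector = alpha ^+ k + #|nbhd E v|%:R.
Proof.
rewrite /power_sum; under eq_bigr => i _ do rewrite -[_ ^+ _]mul1r.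
by rewrite sum_star_vector mul1r sumr_const.
Qed.

(** Each edge through [v] contributes exactly [alpha]; the remaining edges contribute nonnegative
    terms, which are dropped. *)
Lemma qform_star_vector_ge : d = degree E v ->
  d%:R * alpha ^+ k + (\sum_(j in nbhd E v) degree E j)%:R
    + k%:R * (d%:R * alpha) <= qform k E star_vector.
Proof.
move=> dE; rewrite /qform sum_star_vector -dE natr_sum lerD2l.
rewrite ler_wpM2l // (bigID (fun e : {set V} => v \in e)) /= ler_wpDr //.
  by apply: sumr_ge0 => e _; apply: prodr_ge0 => *; apply: star_vector_ge0.
rewrite (eq_bigr (fun=> alpha)) => [|e /andP[eE ve]].
  rewrite sumr_const mulr_natl dE /degree.
  rewrite (@eq_card _ [set e in E | v \in e]
    (fun e => (e \in E) && (v \in e))) // => e.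
  by rewrite inE.
rewrite (prod_edgeD1 _ ve) {1}/star_vector eqxx big1 ?mulr1 // => j.
by rewrite !inE => /andP[jv je]; apply/star_vectorN/nbhdP; split=> //; exists e.
Qed.

Lemma alphaX : (1 + alpha - d%:R) * alpha ^+ k = d%:R * alpha.
Proof.
rewrite alphaE addrAC subrr add0r -{2}(prednK k0) exprSr mulrA -(mulrA d%:R).
by rewrite -exprMn div1r mulVf ?gt_eqF // expr1n mulr1.
Qed.

Lemma star_vector_excess lam : d = degree E v ->
  (forall x, (forall j, 0 <= x j) -> qform k E x <= lam * power_sum k x) ->
  ((\sum_(j in nbhd E v) degree E j)%:R - #|nbhd E v|%:R) +
    alpha * ((d * k.-1)%:R - #|nbhd E v|%:R)
  <= (lam - (1 + alpha)) * (alpha ^+ k + #|nbhd E v|%:R).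
Proof.
move=> dE /(_ _ star_vector_ge0) /(le_trans (qform_star_vector_ge dE)).
rewrite power_sum_star_vector; set D := (\sum_(_ in _) _)%:R.
have kE : k%:R = k.-1%:R + 1 :> R by rewrite -{1}(prednK k0) -natr1.
move=> le_lam; rewrite -subr_ge0; rewrite -subr_ge0 in le_lam.
(* The two sides are in fact equal: after writing [k] as [k.-1 + 1] they differ by a multiple of
   [alphaX]. *)
apply: le_trans le_lam _; rewrite le_eqVlt; apply/orP; left; apply/eqP.
by rewrite natrM kE; have := alphaX; lra.
Qed.

Lemma star_lower_bound lam : d = degree E v ->
  (forall x, (forall j, 0 <= x j) -> qform k E x <= lam * power_sum k x) ->
  1 + alpha <= lam.
Proof.
move=> dE /(star_vector_excess dE) excess.
have pos : 0 < alpha ^+ k + #|nbhd E v|%:R by rewrite ltr_wpDr // exprn_gt0.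
rewrite -subr_ge0 -(pmulr_lge0 _ pos); apply: le_trans excess.
apply: addr_ge0; first by rewrite subr_ge0 ler_nat card_nbhd_le_degree.
by apply: mulr_ge0; [exact: ltW | rewrite subr_ge0 ler_nat dE card_nbhd_le].
Qed.

(* The weights [alpha^(1-k)] at the centre and [alpha] at the other k-1 vertices
   have product 1. *)
Lemma AGM_edge (x : V -> R) e : (forall j, 0 <= x j) -> e \in E -> v \in e ->
  k%:R * \prod_(j in e) x j <=
    (1 / alpha) ^+ k.-1 * x v ^+ k + alpha * \sum_(j in e :\ v) x j ^+ k.
Proof.
move=> x0 eE ve.
pose a j := (if j == v then (1 / alpha) ^+ k.-1 else alpha) * x j ^+ k.
have a0 j : 0 <= a j.
  rewrite /a mulr_ge0 ?exprn_ge0 //.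
  by case: ifP => _; rewrite ?exprn_ge0 ?divr_ge0 ?ltW.
have cardev : #|e :\ v| = k.-1.
  by have := cardsD1 v e; rewrite ve unif // => ->.
have := leif_AGM (A := mem e) (E := a) (fun i _ => a0 i).
have -> : \prod_(i in e) a i = (\prod_(j in e) x j) ^+ k.
  rewrite /a big_split /= prodrXl -[RHS]mul1r; congr (_ * _).
  rewrite (big_setD1 v) //= eqxx (eq_bigr (fun=> alpha)).
    by rewrite prodr_const cardev -exprMn div1r mulVf ?gt_eqF // expr1n.
  by move=> j; rewrite !inE => /andP[/negbTE->].
have -> : \sum_(i in e) a i =
    (1 / alpha) ^+ k.-1 * x v ^+ k + alpha * \sum_(j in e :\ v) x j ^+ k.
  rewrite (big_setD1 v) //= {1}/a eqxx mulr_sumr; congr (_ + _).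
  by apply: eq_bigr => j; rewrite !inE /a => /andP[/negbTE->].
have -> : #|mem e| = k by apply: unif.
move=> [+ _]; set S := _ + _ => le_AGM.
have S0 : 0 <= S.
  apply: addr_ge0; apply: mulr_ge0;
    rewrite ?exprn_ge0 ?divr_ge0 ?(ltW alpha_gt0) //.
  by apply: sumr_ge0 => j _; rewrite exprn_ge0.
rewrite mulrC -ler_pdivlMr ?ltr0n // -(@ler_pXn2r _ k) ?nnegrE ?prodr_ge0 //.
by rewrite divr_ge0.
Qed.

(** Summing [AGM_edge] over the edges leaves the coefficient [d_v (1 + alpha^(1-k))] at the centre,
    at most [1 + alpha] by [alphaE], and [d_j (1 + alpha)] with [d_j <= 1] elsewhere. The degree of
    [v] is only bounded by [d] because the centre of a given hyperstar may differ from the chosen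
    vertex of maximum degree. *)
Lemma star_upper_bound (x : V -> R) : is_star E v -> (degree E v <= d)%N ->
  (forall j, 0 <= x j) -> qform k E x <= (1 + alpha) * power_sum k x.
Proof.
move=> [cent deg1] led x0; have xk0 j : 0 <= x j ^+ k by rewrite exprn_ge0.
rewrite /qform mulr_sumr.
have edges : \sum_(e in E) k%:R * \prod_(j in e) x j <=
    (degree E v)%:R * ((1 / alpha) ^+ k.-1 * x v ^+ k) +
    alpha * \sum_(j | j != v) (degree E j)%:R * x j ^+ k.
  apply: le_trans (ler_sum _ (fun e eE => AGM_edge x0 eE (cent e eE))) _.
  rewrite big_split /= sumr_const -[_ *+ _]mulr_natl -mulr_sumr.
  have -> : #|E| = degree E v.
    by apply: eq_card => e; rewrite inE andb_idr // => /cent.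
  rewrite lerD2l ler_wpM2l ?(ltW alpha_gt0) //.
  rewrite (exchange_big_dep (fun j => j != v)) /=; last first.
    by move=> e j _; rewrite !inE => /andP[].
  apply: ler_sum => j jv; rewrite sumr_const mulr_natl.
  rewrite (@eq_card _ _ [set e in E | j \in e]) // => e.
  by rewrite [LHS]unfold_in !inE jv.
apply: le_trans (lerD (lexx _) edges) _.
rewrite /power_sum (bigD1 v) //= [leRHS](_ : _ =
  (1 + alpha) * x v ^+ k + (1 + alpha) * \sum_(j | j != v) x j ^+ k); last first.
  by rewrite (bigD1 v) //= mulrDr.
set S := \sum_(j | _) _ * _; set T := \sum_(j | _) _.
have leST : (1 + alpha) * S <= (1 + alpha) * T.
  rewrite ler_wpM2l ?addr_ge0 ?(ltW alpha_gt0) //; apply: ler_sum => j jv.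
  by rewrite ler_piMl // lern1 deg1.
rewrite -(ler_nat R) in led.
have lev : (degree E v)%:R * ((1 + (1 / alpha) ^+ k.-1) * x v ^+ k) <=
    d%:R * ((1 + (1 / alpha) ^+ k.-1) * x v ^+ k).
  rewrite ler_wpM2r // mulr_ge0 // addr_ge0 // exprn_ge0 //.
  by rewrite divr_ge0 // (ltW alpha_gt0).
by rewrite {1}alphaE; lra.
Qed.

Lemma lower_bound_attained_is_star : (1 < k)%N -> d = degree E v ->
  hconnected E ->
  (forall x, (forall j, 0 <= x j) ->
    qform k E x <= (1 + alpha) * power_sum k x) ->
  is_star E v.
Proof.
move=> k1 dE conn /(star_vector_excess dE); rewrite subrr mul0r => excess.
have ND := card_nbhd_le_degree E v.
have Nd := card_nbhd_le v unif; rewrite -dE in Nd.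
(* Two nonnegative terms have sum at most 0, so the first one vanishes. *)
have N_eq : (#|nbhd E v| = \sum_(j in nbhd E v) degree E j)%N.
  apply/eqP; rewrite eqn_leq ND /= -(ler_nat R) -subr_le0.
  apply: le_trans excess; rewrite lerDl mulr_ge0 ?(ltW alpha_gt0) //.
  by rewrite subr_ge0 ler_nat.
apply: neighbours_degree1_is_star => //; first by move=> e /unif->.
move=> e j eE ve je jv; apply: (nbhd_degree1 N_eq).
by apply/nbhdP; split=> //; exists e.
Qed.

End Extremal.

(** * The largest root of the polynomial defining [alpha] *)

Lemma alpha_greatest_root (R : realType) (k d : nat) : (1 < k)%N -> (0 < d)%N ->
  exists alpha : R,
    [/\ is_greatest (fun a => root (alpha_poly R k d) a) alpha,
        d%:R - 1 < alpha <= d%:R, 0 < alpha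
      & 1 + alpha = d%:R + d%:R * (1 / alpha) ^+ k.-1].
Proof.
move=> k1 d0.
have k2 : (0 < k.-1)%N by rewrite -ltnS prednK // ltnW.
have evalE (a : R) : (alpha_poly R k d).[a] = a ^+ k.-1 * (a + 1 - d%:R) - d%:R.
  rewrite /alpha_poly !hornerE -{1}(prednK (ltnW k1)) exprS; ring.
have d1 : 1 <= d%:R :> R by rewrite ler1n.
(* The factored form takes the value [-d] at [d - 1] and [d^(k-1) - d >= 0] at [d]. *)
have p_sign : (alpha_poly R k d).[d%:R - 1] <= 0 <= (alpha_poly R k d).[d%:R].
  rewrite !evalE subrK subrr mulr0 sub0r oppr_le0 ler0n addrAC subrr add0r mulr1.
  by rewrite subr_ge0 -{1}[d%:R]expr1 ler_weXn2l.
have led : d%:R - 1 <= d%:R :> R by rewrite lerBlDr lerDl.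
have [alpha /andP[lea aled] ra] := poly_ivt led p_sign.
have lta : d%:R - 1 < alpha.
  rewrite lt_neqAle lea andbT; apply/eqP => aE; move: ra.
  rewrite -aE rootE evalE subrK subrr mulr0 sub0r oppr_eq0.
  by rewrite gt_eqF // (lt_le_trans ltr01).
have a0 : 0 < alpha by lra.
exists alpha; split=> //.
- split=> // y ry; rewrite leNgt; apply/negP => lty.
  move: ry ra; rewrite !rootE !evalE !subr_eq0 => /eqP ry /eqP ra.
  (* Both factors are positive at [alpha] and strictly increasing beyond it, so no larger root
     exists. *)
  suff : alpha ^+ k.-1 * (alpha + 1 - d%:R) < y ^+ k.-1 * (y + 1 - d%:R).
    by rewrite ra ry ltxx.
  apply: ltr_pM => //; [exact: exprn_ge0 (ltW a0) | by lra | | by lra].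
  by rewrite ltrXn2r // ?nnegrE ?(ltW a0) ?(ltW (lt_trans a0 lty)) // -lt0n.
- by rewrite lta.
- move: ra; rewrite rootE evalE subr_eq0 => /eqP ra.
  (* The root equation reads [d = alpha^(k-1) (alpha + 1 - d)]; it is substituted for the factor [d]
     of the power, which then cancels. *)
  rewrite -[X in X * _ ^+ _]ra mulrAC -exprMn div1r mulfV ?gt_eqF // expr1n.
  by ring.
Qed.

(** * From tensor entries to sums over edges *)

Lemma big_tuple_ohead (R : nmodType) (T : finType) k (i : T)
    (F : k.+1.-tuple T -> R) :
  \sum_(t : k.+1.-tuple T | ohead t == Some i) F t =
  \sum_(s : k.-tuple T) F [tuple of i :: s].
Proof.
rewrite (reindex_onto (fun s : k.-tuple T => [tuple of i :: s])
                      (fun t => [tuple of behead t])) /=.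
  by apply: eq_bigl => s; rewrite eqxx; apply/eqP/val_inj.
by move=> t; rewrite (tuple_eta t) => /eqP[<-]; apply: val_inj.
Qed.

(** The tuple has as many entries as [e] has elements, so covering [e] and listing elements of [e]
    without repetition are the same by counting. *)
Lemma set_cons_tuple_eq (T : finType) k (i : T) (e : {set T}) (s : k.-tuple T) :
  #|e| = k.+1 -> i \in e ->
  ([set j in [tuple of i :: s]] == e) = all [in e :\ i] s && uniq s.
Proof.
move=> ce ie; apply/eqP/andP => [eE|[/allP se us]].
  have : uniq (i :: s).
    by apply/card_uniqP; rewrite /= size_tuple -ce -eE cardsE; apply: eq_card.
  rewrite /= => /andP[ni us]; split=> //; apply/allP => j js.
  rewrite inE -eE !inE js orbT andbT; by apply: contraNneq ni => <-.
apply/eqP; rewrite eqEcard; apply/andP; split.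
  apply/subsetP => j; rewrite !inE => /predU1P[->//|/se].
  by rewrite !inE => /andP[].
rewrite ce cardsE (card_uniqP _) ?size_tuple //= us andbT.
by apply/negP => /se; rewrite !inE eqxx.
Qed.

Section TensorApply.
Variables (R : realType) (n : nat) (E : {set {set 'I_n}}) (x : 'rV[R]_n).
Variables (k : nat) (i : 'I_n).

Lemma tensor_apply_degree :
  tensor_apply (degree_tensor R k.+1 E) x i = (degree E i)%:R * x 0 i ^+ k.
Proof.
rewrite /tensor_apply big_tuple_ohead (bigD1 [tuple of nseq k i]) //=.
rewrite [X in _ + X]big1 ?addr0 => [|s sN].
  rewrite ffunE (big_pred1 i) ?big_nseq; last first.
    move=> j /=; rewrite -val_eqE /= eqseq_cons eq_sym.
    by have [->|] := eqVneq j i; rewrite ?eqxx.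
  by congr (_ * _); rewrite -Monoid.iteropE.
rewrite ffunE [X in X * _]big_pred0 ?mul0r // => j; apply: contraNF sN.
by rewrite -!val_eqE /= eqseq_cons => /andP[/eqP-> /eqP->].
Qed.

(** The tuples are grouped by the edge they span. Each edge at [i] arises from the [k!] orderings of
    its other [k] vertices, which cancels the entry [1/k!]; the uniformity here is [k.+1]. *)
Lemma tensor_apply_adjacency : uniform k.+1 E ->
  tensor_apply (adjacency_tensor R k.+1 E) x i = link_sum E (fun j => x 0 j) i.
Proof.
move=> unif; rewrite /tensor_apply big_tuple_ohead.
pose st (s : k.-tuple 'I_n) := [set j in [tuple of i :: s]].
under eq_bigr => s _ do rewrite ffunE -/(st s) (fun_if (fun c => c * _)) mul0r.
rewrite -big_mkcond /=.
rewrite (partition_big st (fun e => (e \in E) && (i \in e))) /=; last first.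
  by move=> s ->; rewrite /st !inE eqxx.
apply: eq_bigr => e /andP[eE ie].
rewrite (eq_bigl (fun s : k.-tuple 'I_n =>
    s \in [set s : k.-tuple 'I_n | all [in e :\ i] s & uniq s])); last first.
  move=> s; rewrite inE -set_cons_tuple_eq ?unif // -/(st s).
  by have [->|] := eqVneq (st s) e; rewrite ?eE ?andbF.
rewrite (eq_bigr (fun=> k`!%:R^-1 * \prod_(j in e :\ i) x 0 j)); last first.
  move=> s; rewrite inE => su; congr (_ * _).
  have /andP[/allP se us] := su; rewrite big_uniq //; apply: eq_bigl => j.
  apply/idP/idP => [/se //|]; move: su.
  rewrite -set_cons_tuple_eq ?unif // => /eqP <-.
  by rewrite !inE => /andP[/negbTE->].
rewrite sumr_const card_uniq_tuples.
have -> : #|[in e :\ i]| = k.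
  by have := cardsD1 i e; rewrite ie unif // => -[].
by rewrite ffactnn -mulrnAl -mulr_natr mulVf ?mul1r // pnatr_eq0 -lt0n fact_gt0.
Qed.

End TensorApply.

Lemma tensor_apply_signless (R : realType) n (E : {set {set 'I_n}}) k
    (x : 'rV[R]_n) i : (0 < k)%N -> uniform k E ->
  tensor_apply (signless_laplacian R k E) x i =
  (degree E i)%:R * x 0 i ^+ k.-1 + link_sum E (fun j => x 0 j) i.
Proof.
case: k => // k _ unif; rewrite -tensor_apply_degree.
rewrite -(@tensor_apply_adjacency _ _ E x k) //.
rewrite /tensor_apply -big_split; apply: eq_bigr => t _ /=.
by rewrite ffunE mulrDl.
Qed.

(** * Existence of a maximizer of the quotient of [qform] by [power_sum] *)

Lemma continuous_qform (R : realType) n k (E : {set {set 'I_n}}) :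
  continuous (fun x : 'rV[R]_n => qform k E (fun j => x 0 j)).
Proof.
have co (j : 'I_n) : continuous (fun x : 'rV[R]_n => x 0 j).
  exact: coord_continuous.
have addc : continuous (fun z : R * R => z.1 + z.2) by exact: add_continuous.
have mulc : continuous (fun z : R * R => z.1 * z.2) by exact: mul_continuous.
have co_exp (j : 'I_n) : continuous (fun x : 'rV[R]_n => x 0 j ^+ k).
  by move=> x; apply: continuous_comp (@co j x) (@exprn_continuous R k _).
have cdeg : continuous
    (fun x : 'rV[R]_n => \sum_i (degree E i)%:R * x 0 i ^+ k).
  apply: (continuous_big addc) => i _ x.
  exact: (cvgMl_tmp (co_exp i x)).
have cedge : continuous
    (fun x : 'rV[R]_n => \sum_(e in E) \prod_(j in e) x 0 j).
  by apply: (continuous_big addc) => e _; apply: (continuous_big mulc).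
by move=> x; apply: (cvgD (cdeg x) (cvgMl_tmp (cedge x))).
Qed.

Lemma continuous_power_sum (R : realType) n k :
  continuous (fun x : 'rV[R]_n => power_sum k (fun j => x 0 j)).
Proof.
have addc : continuous (fun z : R * R => z.1 + z.2) by exact: add_continuous.
apply: (continuous_big addc) => i _ x.
exact: (continuous_comp (@coord_continuous _ _ _ 0 i x)
                        (@exprn_continuous R k _)).
Qed.

(** The simplex is closed and lies in the compact cube [[0,1]^n], since each coordinate is at most
    the total 1. *)
Lemma simplex_compact (R : realType) n :
  compact [set x : 'rV[R]_n |
    (forall i, 0 <= x 0 i) /\ \sum_i x 0 i = 1]%classic.
Proof.
apply: (@subclosed_compact _ _
    [set x : 'rV[R]_n | forall i, `[0, 1]%classic (x 0 i)]%classic); last 2 first.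
- exact: (@rV_compact _ n (fun=> _) (fun i => @segment_compact R 0 1)).
- move=> x [x0 x1] i /=; rewrite in_itv /= x0 -x1 (bigD1 i) //= lerDl.
  by apply: sumr_ge0.
have addc : continuous (fun z : R * R => z.1 + z.2) by exact: add_continuous.
have closed0 : topology_structure.closed
    (\bigcap_i [set x : 'rV[R]_n | 0 <= x 0 i])%classic.
  apply: closed_bigI => i _.
  apply: (@preimage_closed _ _ (fun x : 'rV[R]_n => x 0 i))
    (@closed_ge _ 0) => x _.
  exact: coord_continuous.
have closed1 : topology_structure.closed
    [set x : 'rV[R]_n | \sum_i x 0 i = 1]%classic.
  apply: (@preimage_closed _ _ (fun x : 'rV[R]_n => \sum_i x 0 i))
    (@closed_eq _ 1).
  move=> x _; apply: (continuous_big addc) => i _; exact: coord_continuous.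
have -> : [set x : 'rV[R]_n |
    (forall i, 0 <= x 0 i) /\ \sum_i x 0 i = 1]%classic =
    ((\bigcap_i [set x : 'rV[R]_n | 0 <= x 0 i]) `&`
     [set x : 'rV[R]_n | \sum_i x 0 i = 1])%classic.
  by apply/seteqP; split=> x /= [h0 h1]; split=> // i *; apply: h0.
exact: closedI.
Qed.

Lemma rayleigh_max (R : realType) n k (E : {set {set 'I_n}}) :
  (0 < n)%N -> (0 < k)%N -> uniform k E ->
  exists (lam : R) (x : 'I_n -> R),
    [/\ forall j, 0 <= x j, exists i, x i != 0,
        qform k E x = lam * power_sum k x
      & forall y, (forall j, 0 <= y j) -> qform k E y <= lam * power_sum k y].
Proof.
case: n E => // n E _ k0 unif.
pose A := [set x : 'rV[R]_n.+1 |
  (forall i, 0 <= x 0 i) /\ \sum_i x 0 i = 1]%classic.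
pose f (x : 'rV[R]_n.+1) :=
  qform k E (fun j => x 0 j) / power_sum k (fun j => x 0 j).
have nz (x : 'rV[R]_n.+1) : A x -> exists i, x 0 i != 0.
  move=> [x0 x1]; apply/existsP; apply: contraT.
  rewrite negb_exists => /forallP h.
  move: x1; rewrite big1 => [/esym/eqP|i _]; first by rewrite oner_eq0.
  by apply/eqP; have := h i; rewrite negbK.
have ps_gt0 x : A x -> 0 < power_sum k (fun j => x 0 j).
  move=> Ax; have [i xi] := nz x Ax; case: Ax => x0 _.
  exact: (@power_sum_gt0 _ _ k (fun j => x 0 j) i).
have A_neq0 : (A !=set0)%classic.
  exists (delta_mx 0 0); split=> [i|]; first by rewrite mxE ler0n.
  rewrite (bigD1 0) //= mxE !eqxx big1 ?addr0 // => i /negbTE i0.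
  by rewrite mxE i0 andbF.
have fc : {within A, continuous f}%classic.
  apply: continuous_in_subspaceT => x /set_mem Ax.
  have ps_neq0 : power_sum k (fun j => x 0 j) != 0 by rewrite gt_eqF // ps_gt0.
  apply: (cvgM (@continuous_qform R _ k E x)).
  exact: (cvgV ps_neq0 (@continuous_power_sum R _ k x)).
have [c] := compact_EVT_max A_neq0 (@simplex_compact R n.+1) fc.
move=> /set_mem Ac cmax.
exists (f c), (fun j => c 0 j); split; [by case: Ac | exact: nz | |].
  by rewrite /f divfK // gt_eqF // ps_gt0.
move=> y y0; pose r := \sum_i y i.
have r0 : 0 <= r by apply: sumr_ge0.
have [r_eq0|r_neq0] := eqVneq r 0.
  (* Here [y] is zero; writing it as [0 * y] lets homogeneity turn both sides into 0. *)
  have y_eq0 : y =1 (fun j => 0 * y j).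
    move=> i; apply/eqP; rewrite mul0r; move/eqP: r_eq0.
    by rewrite psumr_eq0 // => /allP/(_ i); rewrite mem_index_enum; apply.
  rewrite (eq_qform _ _ y_eq0) (eq_power_sum _ y_eq0) qformZ // power_sumZ.
  by rewrite expr0n eqn0Ngt k0 !mul0r mulr0.
have r_gt0 : 0 < r by rewrite lt_neqAle eq_sym r_neq0.
(* Both forms are homogeneous of degree [k], so the bound at the rescaled point of the simplex
   carries over to [y]. *)
pose z : 'rV[R]_n.+1 := \row_j (y j / r).
have yE : y =1 (fun j => r * z 0 j) by move=> j; rewrite mxE mulrC divfK.
have Az : A z.
  split=> [i|]; first by rewrite mxE divr_ge0.
  by under eq_bigr => i _ do rewrite mxE; rewrite -mulr_suml divff.
have := cmax z (mem_set Az).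
rewrite {1}/f ler_pdivrMr ?ps_gt0 // => le_z.
rewrite (eq_qform _ _ yE) (eq_power_sum _ yE) qformZ // power_sumZ mulrCA.
by rewrite ler_wpM2l ?exprn_ge0.
Qed.

(** * First-order conditions at a maximizer *)

Lemma poly_max_deriv (R : realType) (p : {poly R}) s : 0 < s ->
  (forall t, 0 <= t -> p.[t] <= p.[s]) -> p^`().[s] = 0.
Proof.
move=> s0 pmax.
have s1 : 0 <= s + 1 by rewrite addr_ge0 // ltW.
have s_in : s \in `]0, s + 1[ by rewrite in_itv /= s0 ltrDl ltr01.
have dp t : t \in `]0, s + 1[ -> derivable (horner p) t 1.
  by move=> _; apply: derivable_horner.
have pmax' t : t \in `]0, s + 1[ -> p.[t] <= p.[s].
  by rewrite in_itv /= => /andP[/ltW t0 _]; apply: pmax.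
have d0 := derive1_at_max s1 dp s_in pmax'.
rewrite -(derive_val (is_derive := is_derive_poly p s)).
exact: (derive_val (is_derive := d0)).
Qed.

Lemma maximizer_eigenvector (R : realType) (V : finType) k (E : {set {set V}})
    (lam : R) (x : V -> R) : (1 < k)%N ->
  (forall j, 0 <= x j) -> qform k E x = lam * power_sum k x ->
  (forall y, (forall j, 0 <= y j) -> qform k E y <= lam * power_sum k y) ->
  forall i, (degree E i)%:R * x i ^+ k.-1 + link_sum E x i = lam * x i ^+ k.-1.
Proof.
move=> k1 x0 xmax ymax i; set S := link_sum E x i.
have k0 := ltnW k1.
have k2 : (0 < k.-1)%N by rewrite -ltnS prednK.
pose a := lam - (degree E i)%:R.
(* Compares the maximizer with the vector whose coordinate [i] is moved to [t]. *)
have variation t : 0 <= t -> k%:R * (t - x i) * S <= a * (t ^+ k - x i ^+ k).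
  move=> t0; have := ymax (upd x i t); rewrite qform_upd power_sum_upd xmax.
  have y0 j : 0 <= upd x i t j by rewrite /upd; case: ifP.
  by move=> /(_ y0); rewrite /a -/S; lra.
suff : S = a * x i ^+ k.-1 by move=> ->; rewrite /a; ring.
have := x0 i; rewrite le_eqVlt => /predU1P[xi0|xi_gt0].
  rewrite -xi0 expr0n eqn0Ngt k2 mulr0.
  apply/eqP; rewrite eq_le link_sum_ge0 // andbT leNgt; apply/negP => S0.
  (* At [x i = 0] the value [S] has to be 0. If [S > 0], this [t] lies in []0, 1]] and satisfies
     [|a| t < S], so [a t^(k-1) <= |a| t < S <= k S], against [variation] divided by [t]. *)
  pose t := S / (S + `|a| + 1).
  have D0 : 0 < S + `|a| + 1 by rewrite ltr_wpDl // addr_ge0 // ltW.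
  have t0 : 0 < t by rewrite divr_gt0.
  have t1 : t <= 1 by rewrite ler_pdivrMr // mul1r -addrA lerDl addr_ge0.
  have := variation t (ltW t0); rewrite -xi0 subr0 expr0n eqn0Ngt k0 subr0.
  have -> : t ^+ k = t ^+ k.-1 * t by rewrite -exprSr prednK.
  rewrite mulrAC [leRHS]mulrA ler_pM2r //.
  apply/negP; rewrite -ltNge.
  have tk : t ^+ k.-1 <= t by rewrite -[leRHS]expr1 ler_wiXn2l // ltW.
  have le_a : a * t ^+ k.-1 <= `|a| * t.
    apply: le_trans (ler_wpM2r _ (ler_norm a)) _.
      by rewrite exprn_ge0 // ltW.
    by rewrite ler_wpM2l.
  apply: le_lt_trans le_a _; apply: (@lt_le_trans _ _ S).
    rewrite mulrA ltr_pdivrMr // mulrC ltr_pM2l // -addrAC ltrDr.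
    by rewrite ltr_wpDr // ltW.
  by rewrite ler_peMl ?(ltW S0) // ler1n.
(* For [x i > 0], [variation] says that [p] is maximal at [x i] among all [t >= 0]; its derivative
   there is [k] times the defect in the eigenvalue equation. *)
pose p : {poly R} := (k%:R * S) *: 'X - a *: 'X^k.
have := @poly_max_deriv _ p (x i) xi_gt0.
have -> : p^`().[x i] = k%:R * (S - a * x i ^+ k.-1).
  by rewrite /p derivB !derivZ derivX derivXn hornerD hornerN !hornerZ hornerC
    hornerMn hornerXn -mulr_natl; ring.
have pE t : p.[t] = k%:R * S * t - a * t ^+ k.
  by rewrite /p hornerD hornerN !hornerZ hornerX hornerXn.
move=> /(_ _)/eqP; rewrite mulf_eq0 pnatr_eq0 eqn0Ngt k0 /= subr_eq0 => h.
apply/eqP/h => t t0; rewrite !pE; have := variation t t0; lra.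
Qed.

Theorem theorem4p1 (R : realType) (k n d : nat) (E : {set {set 'I_n}})
    (hk : (3 <= k)%N) (hkn : (k <= n)%N)
    (hE : E != set0) (hunif : uniform k E) (hconn : hconnected E)
    (hd : d = max_degree E) (hd0 : (0 < d)%N) :
  exists lam alpha : R,
    [/\ is_greatest (H_eigenvalue (signless_laplacian R k E)) lam,
        is_greatest (fun a => root (alpha_poly R k d) a) alpha,
        d%:R - 1 < alpha <= d%:R,
        d%:R + d%:R * (1 / alpha) ^+ k.-1 <= lam
      & lam = d%:R + d%:R * (1 / alpha) ^+ k.-1 <-> hyperstar k E].
Proof.
have k1 : (1 < k)%N by apply: ltn_trans hk.
have k0 := ltnW k1; have n0 := leq_trans k0 hkn.
have [alpha [alpha_root alpha_itv alpha_gt0 alphaE]] :=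
  alpha_greatest_root R k1 hd0.
have [lam [x [x0 [i xi] xmax le_lam]]] := rayleigh_max R n0 k0 hunif.
have eigenE := tensor_apply_signless _ _ k0 hunif.
(* From here on the bound has the form [1 + alpha]. *)
exists lam, alpha; rewrite -alphaE.
have [v dE] : exists v, d = degree E v.
  have [|v _ vmax] := @eq_bigmax_cond _ predT (degree E); last first.
    by exists v; rewrite hd /max_degree vmax.
  by rewrite card_ord.
have le_degree j : (degree E j <= d)%N by rewrite hd; apply: leq_bigmax.
have lower := star_lower_bound k0 alpha_gt0 hunif alphaE dE le_lam.
split=> //.
  split.
    exists (\row_j x j) => [|j].
      by apply/rV0Pn; exists i; rewrite mxE.
    rewrite eigenE !mxE -(maximizer_eigenvector k1 x0 xmax le_lam).
    congr (_ + _).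
    by apply: eq_bigr => e _; apply: eq_bigr => l _; rewrite mxE.
  move=> mu [y /rV0Pn y0 hy].
  apply: (eigenvalue_le k0 hunif le_lam (x := fun j => y 0 j)) => // j.
  by rewrite -eigenE hy.
split=> [lamE|/hyperstar_is_star[w star_w]].
  apply: (@is_star_hyperstar _ _ _ v) => //; move: le_lam; rewrite lamE.
  exact: lower_bound_attained_is_star dE hconn.
(* The upper bound on hyperstars is evaluated at the maximizer [x] and divided by
   [power_sum k x > 0]. *)
apply/le_anti; rewrite lower andbT.
have := star_upper_bound k0 alpha_gt0 hunif alphaE star_w (le_degree w) x0.
by rewrite xmax ler_pM2r // (power_sum_gt0 _ x0 xi).
Qed.
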